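(* Let $V_\epsilon(x)=V_0(x)+V_1(x,x/\epsilon)$, $\epsilon>0$, be a multiscale potential on $\mathbb{R}^n$ as in the context, and assume that $V_1$ has bounded oscillation uniformly in $\epsilon$, i.e. $\operatorname{osc}V_1=\sup_x V_1(x,x/\epsilon)-\inf_x V_1(x,x/\epsilon)$ is bounded by a finite constant independent of $\epsilon$. Assume the sampling strategy's proposal kernel $q(x\to y)$ (which may depend on $\epsilon$) satisfies $$C\,q_0(x\to y)\le q(x\to y)\le D\,q_0(x\to y)\quad\text{for all }x,y,$$ where $q_0(x\to y)$ is an $\epsilon$-independent proposal kernel and $C,D>0$ are constants. Let $\mathcal{T}_\epsilon$ be the transition operator of the chain with proposals $q$ sampling $\mu$, and $\mathcal{T}_0$ the transition operator of the chain with proposals $q_0$ (and the same acceptance rule) sampling $\mu_0$. Then $$e^{-3\operatorname{osc}V_1}\frac{C}{D}\,\mathrm{Gap}(\mathcal{T}_0)\le \mathrm{Gap}(\mathcal{T}_\epsilon)\le e^{3\operatorname{osc}V_1}\frac{D}{C}\,\mathrm{Gap}(\mathcal{T}_0).$$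
   Context: Potentials. $V_0:\mathbb{R}^n\to\mathbb{R}$ is smooth, bounded below, trapping ($V_0(x)\to\infty$ as $|x|\to\infty$), with $e^{-V_0}$ integrable; $V_1(x,y)$ is smooth and bounded. The inverse temperature is $\beta=1$. Put $\mu(dx)=Z^{-1}e^{-V_\epsilon(x)}dx$ and $\mu_0(dx)=Z_0^{-1}e^{-V_0(x)}dx$, with $Z,Z_0$ the normalizing constants ($\mu$ depends on $\epsilon$). Sampler. For a target density proportional to $e^{-V}$ and a proposal kernel with (positive) probability density $q(x\to y)$ in $y$, set $R(x,y)=V(x)-V(y)+\log\frac{q(y\to x)}{q(x\to y)}$. Given $X_k$, a proposal $X^{\mathrm p}_{k+1}\sim q(X_k\to\cdot)$ is drawn; with probability $F(R(X_k,X^{\mathrm p}_{k+1}))$ one sets $X_{k+1}=X^{\mathrm p}_{k+1}$, otherwise $X_{k+1}=X_k$. Here $F$ is either the Metropolis rule $F(r)=\min(1,e^{r})$ or the Barker rule $F(r)=(1+e^{-r})^{-1}$. Spectral gap. For a chain reversible with respect to a probability measure $\pi$ with transition operator $\mathcal{T}$ on $L^2(\pi)$, $\mathrm{Gap}(\mathcal{T})=1-\sup_{\lambda\in\sigma(\mathcal{T})\setminus\{1\}}\lambda$, used in its Dirichlet-form (variational) expression $$\mathrm{Gap}(\mathcal{T})=\inf_{f\in L^2(\pi),\ \mathrm{Var}_\pi(f)>0}\frac{\mathbb{E}_\pi[|f(X_{k+1})-f(X_k)|^2]}{2\,\mathrm{Var}_\pi(f(X))},$$ where $\mathbb{E}_\pi$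 is taken over one step of the chain started from $X_k\sim\pi$. *)

(* Defs.v *)
From HB Require Import structures.
From mathcomp Require Import all_boot all_order all_algebra.
From mathcomp Require Import all_classical all_reals all_analysis.
From mathcomp Require Import measurable_realfun.

Set Implicit Arguments.
Unset Strict Implicit.
Unset Printing Implicit Defensive.

Import Order.TTheory GRing.Theory Num.Theory.
Import numFieldNormedType.Exports.
Import HBNNSimple.

Local Open Scope classical_set_scope.
Local Open Scope ring_scope.

Section measurable_rV.
Context {R : realType} {n : nat}.

Let coord (i : 'I_n) (x : 'rV[R]_n) : measurableTypeR R := x ord0 i.

Let rV_set0 : g_sigma_preimage coord set0.
Proof. exact: sigma_algebra0. Qed.

Let rV_setC A : g_sigma_preimage coord A -> g_sigma_preimage coord (~` A).
Proof. exact: sigma_algebraC. Qed.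

Let rV_bigcup (F : (set 'rV[R]_n)^nat) :
  (forall i, g_sigma_preimage coord (F i)) ->
  g_sigma_preimage coord (\bigcup_i (F i)).
Proof. exact: sigma_algebra_bigcup. Qed.

(* The sigma-algebra generated by the coordinates; it is the Borel
   sigma-algebra of R^n. *)
HB.instance Definition _ := @isMeasurable.Build default_measure_display
  'rV[R]_n (g_sigma_preimage coord) rV_set0 rV_setC rV_bigcup.

Lemma measurable_coord (i : 'I_n) :
  measurable_fun [set: 'rV[R]_n] (fun x => x ord0 i : measurableTypeR R).
Proof.
move=> _ Y mY; rewrite setTI; apply: sub_sigma_algebra => /=.
rewrite -bigcup_seq/=; exists i => /=; first by rewrite mem_index_enum.
by exists Y => //; rewrite setTI.
Qed.

Lemma measurable_fun_rVP d (T : measurableType d) (f : T -> 'rV[R]_n) :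
  (forall i, measurable_fun [set: T] (fun x => f x ord0 i : measurableTypeR R)) ->
  measurable_fun [set: T] f.
Proof.
move=> mf _ A mA; rewrite setTI.
suff : g_sigma_preimage coord `<=` [set B | measurable (f @^-1` B)].
  by apply.
apply: smallest_sub.
  split => /=.
  - by rewrite preimage_set0.
  - by move=> B mB; rewrite setTD -preimage_setC; exact: measurableC.
  - by move=> F mF; rewrite preimage_bigcup; exact: bigcupT_measurable.
move=> B; rewrite -bigcup_seq => -[i _ [Y mY <-]] /=.
rewrite setTI.
by have := mf i measurableT Y mY; rewrite setTI.
Qed.

End measurable_rV.

Section lebesgue_rV.
Context {R : realType}.

Definition rV_cons n (p : measurableTypeR R * 'rV[R]_n) : 'rV[R]_n.+1 :=
  row_mx (p.1%:M : 'rV_1) p.2.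

Lemma measurable_rV_cons n : measurable_fun [set: _ * _] (@rV_cons n).
Proof.
apply: measurable_fun_rVP => i.
case: (@split_ordP 1 n i) => j ->.
  rewrite [X in measurable_fun _ X](_ : _ = fst) //.
  by apply/funext => p; rewrite /rV_cons (row_mxEl p.1%:M) mxE !ord1 mulr1n.
rewrite [X in measurable_fun _ X](_ : _ =
  (fun x : 'rV[R]_n => x ord0 j : measurableTypeR R) \o snd).
  apply: measurableT_comp => //; exact: measurable_coord.
by apply/funext => p; rewrite /rV_cons (row_mxEr p.1%:M).
Qed.

Section step.
Context n (m : {sigma_finite_measure set 'rV[R]_n -> \bar R}).

Definition lebesgue_rV_step : set 'rV[R]_n.+1 -> \bar R :=
  pushforward (lebesgue_measure \x m)%E (@rV_cons n).

Let mcons := @measurable_rV_cons n.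

Let step0 : lebesgue_rV_step set0 = 0%E.
Proof. exact: measure0. Qed.

Let step_ge0 A : (0 <= lebesgue_rV_step A)%E.
Proof. exact: measure_ge0. Qed.

Let step_sigma_additive : semi_sigma_additive lebesgue_rV_step.
Proof. exact: measure_semi_sigma_additive. Qed.

HB.instance Definition _ := isMeasure.Build _ _ _ lebesgue_rV_step
  step0 step_ge0 step_sigma_additive.

Let step_sigma_finite : sigma_finite setT lebesgue_rV_step.
Proof.
have [F FT Ffin] : sigma_finite setT (lebesgue_measure \x m)%E.
  have /sigma_finiteP[F [TF ndF Foo]] := sigma_finiteT (@lebesgue_measure R).
  have /sigma_finiteP[G [TG ndG Goo]] := sigma_finiteT m.
  exists (fun k => F k `*` G k).
    rewrite -setXTT TF TG predeqE => -[x y]; split.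
      move=> [/= [k _ Fkx] [l _ Gly]]; exists (maxn k l) => //; split.
      - by move: x Fkx; exact/subsetPset/ndF/leq_maxl.
      - by move: y Gly; exact/subsetPset/ndG/leq_maxr.
    by move=> [k _ []/= ? ?]; split; exists k.
  move=> k; have [? ?] := Foo k; have [? ?] := Goo k.
  split; first exact: measurableX.
  by rewrite product_measure1E// lte_mul_pinfty// ge0_fin_numE.
pose uncons (v : 'rV[R]_n.+1) : measurableTypeR R * 'rV[R]_n :=
  (v ord0 ord0, (\row_j v ord0 (rshift 1 j))%R).
have muncons : measurable_fun setT uncons.
  apply/measurable_fun_pairP; split; first exact: measurable_coord.
  apply: measurable_fun_rVP => j.
  rewrite [X in measurable_fun _ X](_ : _ =
    (fun x : 'rV[R]_n.+1 => x ord0 (rshift 1 j) : measurableTypeR R)).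
    exact: measurable_coord.
  by apply/funext => x /=; rewrite mxE.
have consK p : uncons (rV_cons p) = p.
  case: p => a v; rewrite /uncons /rV_cons; congr (_, _).
    have -> : ord0 = @lshift 1 n ord0 by apply/val_inj.
    by rewrite (row_mxEl a%:M) mxE eqxx mulr1n.
  by apply/rowP => j; rewrite mxE (row_mxEr a%:M).
exists (fun k => uncons @^-1` F k).
  by rewrite -preimage_bigcup -FT preimage_setT.
move=> k; have [mF Fk] := Ffin k; split.
  by rewrite -[X in measurable X]setTI; exact: muncons.
rewrite /lebesgue_rV_step /pushforward.
rewrite [X in (_ \x _)%E X](_ : _ = F k)//.
by apply/seteqP; split => p /=; rewrite consK.
Qed.

HB.instance Definition _ :=
  Measure_isSigmaFinite.Build _ _ _ lebesgue_rV_step step_sigma_finite.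
End step.

(* Lebesgue measure on R^n, as an iterated product of the one on R. *)
Fixpoint lebesgue_rV n : {sigma_finite_measure set 'rV[R]_n -> \bar R} :=
  match n with
  | 0 => dirac (0 : 'rV[R]_0)
  | m.+1 => lebesgue_rV_step (lebesgue_rV m)
  end.
End lebesgue_rV.
Arguments lebesgue_rV {R} n.

Section with_density.
Local Open Scope ereal_scope.
Context d (T : measurableType d) (R : realType).
Variables (mu : {measure set T -> \bar R}) (f : {nnfun T >-> R}).

(* The measure of density f with respect to mu.  The integral of a nonnegative
   function being a lower integral, this is a measure even when f is not
   measurable. *)
Definition with_density (A : set T) : \bar R := \int[mu]_(x in A) (f x)%:E.

Let f0 D x : D x -> 0 <= (f x)%:E. Proof. by rewrite lee_fin. Qed.

Let le_lower (A B : set T) : A `<=` B -> with_density A <= with_density B.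
Proof.
move=> AB; rewrite /with_density (ge0_integralE mu (@f0 A)).
rewrite (ge0_integralE mu (@f0 B)).
apply: le_ereal_sup => _ [h hf <-]; exists h => //= x.
apply: (le_trans (hf x)); rewrite /patch; case: ifPn => xA.
  by rewrite ifT// inE; apply: AB; rewrite inE in xA.
by case: ifPn => // _; rewrite lee_fin.
Qed.

Let sintegral_le (A : set T) (h : {nnsfun T >-> R}) :
  (forall x, (h x)%:E <= ((EFin \o f) \_ A) x) -> sintegral mu h <= with_density A.
Proof.
move=> hf; rewrite /with_density (ge0_integralE mu (@f0 A)).
by apply: ereal_sup_ubound; exists h.
Qed.

Let with_density0 : with_density set0 = 0.
Proof. by rewrite /with_density integral_set0. Qed.

Let with_density_ge0 A : 0 <= with_density A.
Proof. by apply: integral_ge0 => x _; rewrite lee_fin. Qed.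

Let with_densityU A B : A `&` B = set0 ->
  with_density A + with_density B <= with_density (A `|` B).
Proof.
move=> AB0.
have [->|Uoo] := eqVneq (with_density (A `|` B)) +oo; first exact: leey.
have Ufin C : C `<=` A `|` B -> with_density C \is a fin_num.
  move=> CU; rewrite ge0_fin_numE//.
  by rewrite (le_lt_trans (le_lower CU))// ltey.
have Bfin : with_density B \is a fin_num by apply: Ufin; right.
rewrite -leeBrDr// {1}/with_density (ge0_integralE mu (@f0 A)).
apply: ge_ereal_sup => _ [g gf <-].
have gA : sintegral mu g <= with_density A by exact: sintegral_le.
have gfin : sintegral mu g \is a fin_num.
  rewrite ge0_fin_numE ?sintegral_ge0// (le_lt_trans gA)//.
  by rewrite -ge0_fin_numE//; apply: Ufin; left.
rewrite leeBrDr// -leeBrDl// {1}/with_density (ge0_integralE mu (@f0 B)).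
apply: ge_ereal_sup => _ [h hf <-].
rewrite leeBrDl// -sintegralD; apply: sintegral_le => x /=.
have := gf x; have := hf x; rewrite /patch /= EFinD.
have [xA|xA] := boolP (x \in A); have [xB|xB] := boolP (x \in B).
- by exfalso; move: AB0; apply/eqP/set0P; exists x; split; rewrite -in_setE.
- rewrite ifT; last by rewrite in_setU xA.
  by move=> h0 gx; rewrite -[leRHS]adde0 leeD.
- rewrite ifT; last by rewrite in_setU xB orbT.
  by move=> hx g0; rewrite -[leRHS]add0e leeD.
- rewrite ifF; last by rewrite in_setU (negbTE xA) (negbTE xB).
  by move=> h0 g0; rewrite -[leRHS]add0e leeD.
Qed.

Let with_density_sigma_additive : semi_sigma_additive with_density.
Proof.
move=> F mF tF mUF.
have cvgF : cvgn (fun n => \sum_(0 <= i < n) with_density (F i)).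
  exact: is_cvg_nneseries.
suff <- : \sum_(0 <= i <oo) with_density (F i) = with_density (\bigcup_i F i).
  exact: cvgF.
apply/eqP; rewrite eq_le; apply/andP; split.
  apply: lime_le => //; apply: nearW => n.
  suff /le_trans : \sum_(0 <= i < n) with_density (F i) <=
           with_density (\big[setU/set0]_(i < n) F i).
    apply; apply: le_lower; rewrite -bigcup_mkord => x [k _ Fkx].
    by exists k.
  elim: n => [|n ih]; first by rewrite big_nil.
  rewrite big_nat_recr//= big_ord_recr/=.
  apply: (le_trans (leeD2r _ ih)); apply: with_densityU.
  rewrite -bigcup_mkord setI_bigcupl bigcup0// => k /= kn.
  by move/trivIsetP : tF; apply => //; rewrite lt_eqF.
rewrite {1}/with_density (ge0_integralE mu (@f0 _)).
apply: ge_ereal_sup => _ [h hf <-].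
have -> : sintegral mu h = \int[mu]_(x in \bigcup_i F i) (h x)%:E.
  rewrite integral_nnsfun//; congr sintegral; apply/funext => x.
  rewrite /patch; case: ifPn => // xU.
  apply/eqP; rewrite eq_le fun_ge0 andbT -lee_fin.
  by have := hf x; rewrite /patch (negbTE xU).
rewrite ge0_integral_bigcup//; last 2 first.
- by apply/measurable_EFinP; apply: measurable_funTS.
- by move=> x _; rewrite lee_fin.
apply: lee_nneseries => [i _ _|i _].
  by apply: integral_ge0 => x _; rewrite lee_fin.
rewrite integral_nnsfun// mrestrict; apply: sintegral_le => x.
rewrite -mrestrict /patch; case: ifPn => [xF|//].
have := hf x; rewrite /patch ifT// inE.
by exists i => //; rewrite inE in xF.
Qed.

HB.instance Definition _ := isMeasure.Build _ _ _ with_density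
  with_density0 with_density_ge0 with_density_sigma_additive.

End with_density.

Section smooth.
Context {R : realType} {U : normedModType R}.

(* For finite-dimensional U this is the usual class C^k. *)
Fixpoint class_C (k : nat) (f : U -> R) : Prop :=
  match k with
  | 0 => continuous f
  | k'.+1 => (forall x, differentiable f x) /\
             (forall v, class_C k' (fun x => 'D_v f x))
  end.

Definition smooth (f : U -> R) := forall k, class_C k f.

End smooth.

Section spectral_gap.
Local Open Scope ereal_scope.
Context d (T : measurableType d) (R : realType).
Variables (pi : probability T R) (K : T -> probability T R).

(* E_pi[|f(X_{k+1}) - f(X_k)|^2] for X_k ~ pi and X_{k+1} ~ K(X_k, .) *)
Definition mean_square_jump (f : T -> R) : \bar R :=
  \int[pi]_x \int[K x]_y ((`|f y - f x| ^+ 2)%R)%:E.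

(* The variational expression of the gap of the transition operator
   f |-> (x |-> \int[K x]_y f y) on L^2(pi), for K reversible w.r.t. pi. *)
Definition Gap : \bar R :=
  ereal_inf [set mean_square_jump f / (2%:E * 'V_pi[f])
            | f in [set f | f \in Lfun pi 2%:E /\ 0 < 'V_pi[f]]].

End spectral_gap.

Section sampler.
Context {R : realType} {n : nat}.
Implicit Types V : 'rV[R]_n -> R.

Definition gibbs_weight V (x : 'rV[R]_n) : R := expR (- V x).

HB.instance Definition _ V := isNonNegFun.Build _ _ (gibbs_weight V)
  (fun x => expR_ge0 (- V x)).

(* Z^-1 e^{-V(x)} dx.  The second argument of mnormalize is a junk value used
   only when Z is 0 or +oo. *)
Definition gibbs V : probability 'rV[R]_n R :=
  mnormalize (with_density (lebesgue_rV n) (gibbs_weight V))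
             (dirac (0 : 'rV[R]_n)).

Record proposal := Proposal {
  proposal_density :> 'rV[R]_n -> 'rV[R]_n -> R ;
  proposal_measurable : measurable_fun [set: 'rV[R]_n * 'rV[R]_n]
    (fun z => proposal_density z.1 z.2 : measurableTypeR R) ;
  proposal_gt0 : forall x y, 0 < proposal_density x y ;
  proposal_int1 : forall x,
    (\int[lebesgue_rV n]_y (proposal_density x y)%:E = 1)%E }.

Variant acceptance_rule := Metropolis | Barker.

Definition acceptance (F : acceptance_rule) (r : R) : R :=
  match F with
  | Metropolis => Num.min 1 (expR r)
  | Barker => (1 + expR (- r))^-1
  end.

Lemma acceptance_ge0 F r : 0 <= acceptance F r.
Proof.
case: F; first by rewrite /= le_min ler01 expR_ge0.
by rewrite /= invr_ge0 addr_ge0// expR_ge0.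
Qed.

Lemma acceptance_le1 F r : acceptance F r <= 1.
Proof.
case: F; first by rewrite /= ge_min lexx.
by rewrite /= invf_le1 ?lerDl ?expR_ge0// ltr_wpDr ?expR_ge0.
Qed.

Variables (F : acceptance_rule) (V : 'rV[R]_n -> R) (q : proposal).

Definition log_ratio (x y : 'rV[R]_n) : R :=
  V x - V y + ln (q y x / q x y).

Definition accepted_density (x y : 'rV[R]_n) : R :=
  q x y * acceptance F (log_ratio x y).

Let accepted_density_ge0 x y : 0 <= accepted_density x y.
Proof. by rewrite mulr_ge0 ?acceptance_ge0// ltW// proposal_gt0. Qed.

HB.instance Definition _ x :=
  isNonNegFun.Build _ _ (accepted_density x) (accepted_density_ge0 x).

Definition acceptance_prob (x : 'rV[R]_n) : \bar R :=
  with_density (lebesgue_rV n) (accepted_density x) setT.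

Let acceptance_prob_le1 x : (acceptance_prob x <= 1)%E.
Proof.
rewrite -(proposal_int1 q x) /acceptance_prob /with_density.
rewrite ge0_integralTE; last by move=> y; rewrite lee_fin.
rewrite ge0_integralTE; last first.
  by move=> y; rewrite lee_fin ltW// proposal_gt0.
apply: le_ereal_sup => _ [h hf <-]; exists h => //= y.
apply: (le_trans (hf y)); rewrite lee_fin /accepted_density.
by rewrite ler_piMr ?acceptance_le1// ltW// proposal_gt0.
Qed.

Let acceptance_prob_fin x : acceptance_prob x \is a fin_num.
Proof.
by rewrite ge0_fin_numE ?measure_ge0// (le_lt_trans (acceptance_prob_le1 x))// ltry.
Qed.

Let rejection_ge0 x : 0 <= 1 - fine (acceptance_prob x).
Proof. by rewrite subr_ge0 -lee_fin fineK. Qed.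

(* Law of X_{k+1} given X_k = x *)
Definition mh_law (x : 'rV[R]_n) : set 'rV[R]_n -> \bar R :=
  measure_add (with_density (lebesgue_rV n) (accepted_density x))
              (mscale (NngNum (rejection_ge0 x)) (dirac x)).

HB.instance Definition _ x := Measure.on (mh_law x).

Let mh_law_setT x : mh_law x setT = 1%E.
Proof.
rewrite /mh_law measure_addE; transitivity (acceptance_prob x +
  (1 - fine (acceptance_prob x))%:E * \d_x setT)%E.
  by [].
rewrite [X in (_ + _ * X)%E](_ : _ = 1%E); last exact: diracT.
rewrite mule1 EFinB fineK// [LHS]addeC.
exact: (subeK (1%E : \bar R) (acceptance_prob_fin x)).
Qed.

HB.instance Definition _ x :=
  Measure_isProbability.Build _ _ _ (mh_law x) (mh_law_setT x).

Definition mh_kernel (x : 'rV[R]_n) : probability 'rV[R]_n R := mh_law x.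

(* The gap of the transition operator of the chain that samples
   the density proportional to e^{-V} *)
Definition sampler_gap : \bar R := Gap (gibbs V) mh_kernel.

End sampler.
Arguments proposal R n : clear implicits.

Section multiscale.
Context {R : realType} {n : nat}.

Definition multiscale (V0 : 'rV[R]_n -> R) (V1 : 'rV[R]_n * 'rV[R]_n -> R)
    (eps : R) (x : 'rV[R]_n) : R :=
  V0 x + V1 (x, eps^-1 *: x).

Definition osc (V1 : 'rV[R]_n * 'rV[R]_n -> R) (eps : R) : R :=
  sup (range (fun x : 'rV[R]_n => V1 (x, eps^-1 *: x))) -
  inf (range (fun x : 'rV[R]_n => V1 (x, eps^-1 *: x))).

End multiscale.

(* Main.v *)
(* With o = osc V1, passing from V_0 to V_eps changes the Gibbs measure, in both
   directions, by a factor at most e^o, hence changes variances by a factor at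
   most e^o, since Var(f) = min_c E (f - c)^2.  The accepted-move density is,
   with a = q(x, y) and b = e^(V x - V y) q(y, x), equal to min(a, b)
   (Metropolis) or (1/a + 1/b)^-1 (Barker): both are monotone and homogeneous
   of degree 1 in (a, b), so it changes by a factor between C e^-o and D e^o.
   Rejected moves do not contribute to the mean square jump, so the Rayleigh
   quotients change by a factor between C e^(-3 o) and D e^(3 o).  Finally
   C <= 1 <= D, because q(x, .) and q0(x, .) both have total mass 1. *)
Require Import Defs.
From mathcomp Require Import all_boot all_order all_algebra.
From mathcomp Require Import all_classical all_reals all_analysis.
From mathcomp Require Import measurable_realfun ring lra.

Set Implicit Arguments.
Unset Strict Implicit.
Unset Printing Implicit Defensive.

Import Order.TTheory GRing.Theory Num.Theory.
Import numFieldNormedType.Exports.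
Import HBNNSimple.

Local Open Scope classical_set_scope.
Local Open Scope ring_scope.

(** * Lower integrals under scaled bounds on measure and integrand *)

Section scaled_comparison.
Local Open Scope ereal_scope.
Context d (T : measurableType d) (R : realType).

Lemma sintegral_le_measure (mu nu : {measure set T -> \bar R}) (b : R)
    (s : {nnsfun T >-> R}) :
  (0 <= b)%R -> (forall B, measurable B -> nu B <= b%:E * mu B) ->
  sintegral nu s <= b%:E * sintegral mu s.
Proof.
move=> b0 le_nu.
(* The scaled [mu] is itself a measure dominating [nu], so monotonicity in the measure applies; [b]
   is then pulled out of the finite sum. *)
apply: (@le_trans _ _ (sintegral (mscale (NngNum b0) mu) s)).
  exact: le_measure_sintegral.
rewrite !sintegralET ge0_mule_fsumr; last first.
  by move=> r; exact: nnsfun_mulemu_ge0.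
by under eq_fsbigr do rewrite /mscale/= muleCA.
Qed.

(* Integrals of nonnegative functions being lower integrals, no measurability
   of [h] or [k] is needed. *)
Lemma ge0_integral_le_scale (mu nu : {measure set T -> \bar R}) (a b : R)
    (A : set T) (h k : T -> \bar R) :
  (0 < a)%R -> (0 <= b)%R ->
  (forall B, measurable B -> nu B <= b%:E * mu B) ->
  (forall x, 0 <= h x) -> (forall x, h x <= a%:E * k x) ->
  \int[nu]_(x in A) h x <= (b * a)%:E * \int[mu]_(x in A) k x.
Proof.
move=> a0 b0 le_nu h0 hk.
have k0 x : 0 <= k x.
  by have := le_trans (h0 x) (hk x); rewrite pmule_rge0.
rewrite !ge0_integralE//; apply: ge_ereal_sup => _ [s /= sh <-].
apply: (le_trans (sintegral_le_measure s b0 le_nu)).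
rewrite EFinM -muleA; apply: lee_wpmul2l; first by rewrite lee_fin.
rewrite -lee_pdivrMl// -sintegralrM.
have a'0 : (0 <= a^-1)%R by rewrite invr_ge0 ltW.
(* A simple function below [h], divided by [a], is a competitor in the supremum defining the
   integral of [k]. *)
pose t := mul_nnsfun (cst_nnsfun T (NngNum a'0)) s.
apply: ereal_sup_ubound; exists t => // x.
rewrite /= EFinM lee_pdivrMl//; apply: (le_trans (sh x)).
by rewrite /patch; case: ifPn => // _; rewrite mule0.
Qed.

Lemma with_density_le (mu : {measure set T -> \bar R})
    (f g : {nnfun T >-> R}) (a : R) (A : set T) :
  (0 < a)%R -> (forall x, f x <= a * g x)%R ->
  with_density mu f A <= a%:E * with_density mu g A.
Proof.
move=> a0 fg; rewrite -[a]mul1r; apply: ge0_integral_le_scale => //.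
- by move=> B _; rewrite mul1e.
- by move=> x; rewrite lee_fin.
Qed.

End scaled_comparison.

(** * Square integrability and variance under a change of probability *)

Section variance_comparison.
Local Open Scope ereal_scope.
Context d (T : measurableType d) (R : realType).

(** Separates measurability, which does not depend on [mu], from one integral to which the
    comparison of measures applies. *)
Lemma Lfun2P (mu : {measure set T -> \bar R}) (f : T -> R) :
  (f \in Lfun mu 2%:E) <->
  (measurable_fun setT f /\ \int[mu]_x ((f x) ^+ 2)%:E < +oo).
Proof.
have int_sqr : 'N[mu]_2%:E[EFin \o f] = (\int[mu]_x ((f x) ^+ 2)%:E) `^ 2^-1.
  rewrite unlock; congr (_ `^ _); apply: eq_integral => x _ /=.
  by rewrite powR_mulrn// -normrX ger0_norm ?sqr_ge0.
rewrite inE; split.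
  move=> /andP[/[!inE]/= mf]; rewrite /finite_norm int_sqr => foo; split => //.
  exact: lty_poweRy foo.
move=> [mf foo]; apply/andP; rewrite !inE/=; split => //.
by rewrite /finite_norm int_sqr; exact: poweR_lty.
Qed.

(** Subtracting [c] leaves the variance unchanged, and a variance is a second moment minus a squared
    mean. *)
Lemma variance_le_center (P : probability T R) (f : T -> R) (c : R) :
  f \in Lfun P 2%:E -> 'V_P[f] <= \int[P]_x ((f x - c) ^+ 2)%:E.
Proof.
move=> f2.
have fc2 : (f \- cst c)%R \in Lfun P 2%:E.
  by rewrite rpredB ?lee1n//= => _; exact: Lfun_cst.
rewrite -(varianceB_cst_r c f2) varianceE// -[leRHS]adde0; apply: leeD.
  by rewrite unlock.
by rewrite oppe_le0 sqre_ge0.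
Qed.

Variables (P Q : probability T R) (b : R).
Hypothesis b_ge0 : (0 <= b)%R.
Hypothesis le_QP : forall B, measurable B -> Q B <= b%:E * P B.

Lemma Lfun2_le_measure (f : T -> R) : f \in Lfun P 2%:E -> f \in Lfun Q 2%:E.
Proof.
move=> /Lfun2P[mf foo]; apply/Lfun2P; split => //.
apply: (@le_lt_trans _ _ ((b * 1)%:E * \int[P]_x ((f x) ^+ 2)%:E)).
  apply: ge0_integral_le_scale => // x; first by rewrite lee_fin sqr_ge0.
  by rewrite mul1e.
by rewrite mulr1 lte_mul_pinfty// lee_fin.
Qed.

(** Centering at the mean under [P] bounds the variance under [Q], while the same second moment
    under [P] is exactly the variance. *)
Lemma variance_le_measure (f : T -> R) :
  f \in Lfun P 2%:E -> 'V_Q[f] <= b%:E * 'V_P[f].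
Proof.
move=> f2; apply: le_trans (variance_le_center (fine 'E_P[f]) _) _.
  exact: Lfun2_le_measure.
have -> : 'V_P[f] = \int[P]_x ((f x - fine 'E_P[f]) ^+ 2)%:E.
  by rewrite /variance covariance.unlock expectation.unlock.
rewrite -[b in leRHS]mulr1.
apply: ge0_integral_le_scale => // x; first by rewrite lee_fin sqr_ge0.
by rewrite mul1e.
Qed.

End variance_comparison.

(** * Spectral gap and normalization under two-sided bounds *)

Section gap_comparison.
Local Open Scope ereal_scope.
Context d (T : measurableType d) (R : realType).

Lemma Gap_ge0 (P : probability T R) (K : T -> probability T R) : 0 <= Gap P K.
Proof.
apply: le_ereal_inf_tmp => _ [f [_ Vf0] <-]; apply: mule_ge0.
  by apply: integral_ge0 => x _; apply: integral_ge0 => y _; rewrite lee_fin.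
by rewrite inve_ge0 mule_ge0// ltW.
Qed.

(** In the Rayleigh quotient, the numerator costs [b] for the outer integral and [c] for the kernel;
    the denominator costs another [b]. *)
Lemma Gap_le (P Q : probability T R) (K L : T -> probability T R) (b c : R) :
  (0 < b)%R -> (0 < c)%R ->
  (forall B, measurable B -> Q B <= b%:E * P B) ->
  (forall B, measurable B -> P B <= b%:E * Q B) ->
  (forall (f : T -> R) x, measurable_fun setT f ->
    \int[L x]_y ((`|f y - f x| ^+ 2)%R)%:E <=
    c%:E * \int[K x]_y ((`|f y - f x| ^+ 2)%R)%:E) ->
  Gap Q L <= (b * c * b)%:E * Gap P K.
Proof.
move=> b0 c0 le_QP le_PQ le_LK.
have bcb0 : (0 < b * c * b)%R by rewrite !mulr_gt0.
rewrite -lee_pdivrMl//; apply: le_ereal_inf_tmp => _ [f [f2 Vf0] <-].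
rewrite lee_pdivrMl//.
have [mf _] := (Lfun2P P f).1 f2.
(* A test function for [Gap P K] is admissible for [Gap Q L]: still square integrable, and of
   positive variance under [Q]. *)
have g2 : f \in Lfun Q 2%:E := Lfun2_le_measure (ltW b0) le_QP f2.
have VPQ : 'V_P[f] <= b%:E * 'V_Q[f] := variance_le_measure (ltW b0) le_PQ g2.
have WQ0 : 0 < 'V_Q[f].
  by rewrite -(pmule_rgt0 _ (_ : 0 < b%:E))// (lt_le_trans Vf0).
have jump_le : mean_square_jump Q L f <= (b * c)%:E * mean_square_jump P K f.
  apply: ge0_integral_le_scale => //; first exact: ltW.
  - by move=> x; apply: integral_ge0 => y _; rewrite lee_fin.
  - by move=> x; exact: le_LK.
apply: (@le_trans _ _ (mean_square_jump Q L f / (2%:E * 'V_Q[f]))).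
  by apply: ereal_inf_lbound; exists f.
rewrite [(_ * b)%:E]EFinM -muleA; apply: le_trans (lee_wpmul2r _ jump_le) _.
  by rewrite inve_ge0 mule_ge0// ltW.
rewrite -muleA; apply: lee_wpmul2l; first by rewrite lee_fin mulr_ge0 ?ltW.
rewrite muleCA; apply: lee_wpmul2l.
  by apply: integral_ge0 => x _; apply: integral_ge0 => y _; rewrite lee_fin.
(* Both variances are finite and positive; what remains is the real inequality
   [1 / (2 * w) <= b / (2 * v)], from [v <= b * w]. *)
move: VPQ Vf0 WQ0.
rewrite -(fineK (variance_fin_num f2)) -(fineK (variance_fin_num g2)).
set v := fine _; set w := fine _; rewrite -!EFinM !lte_fin !lee_fin => vw v0 w0.
rewrite !inver !mulf_eq0 !pnatr_eq0/= !gt_eqF// -EFinM lee_fin.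
rewrite -div1r ler_pdivrMr ?mulr_gt0//.
rewrite mulrAC ler_pdivlMr ?mulr_gt0// mul1r; lra.
Qed.

(* [1 <= a * b] covers the junk case where both sides are [P A]. *)
Lemma mnormalize_le (mu nu : {measure set T -> \bar R}) (P : probability T R)
    (a b : R) (A : set T) :
  (0 < a)%R -> (0 < b)%R -> (1 <= a * b)%R ->
  (forall B, mu B <= a%:E * nu B) -> (forall B, nu B <= b%:E * mu B) ->
  mnormalize mu P A <= (a * b)%:E * mnormalize nu P A.
Proof.
move=> a0 b0 ab1 mu_nu nu_mu; rewrite /mnormalize.
(* The total masses are 0 or infinite simultaneously, so both normalizations take the same
   branch. *)
have -> : (mu setT == 0) = (nu setT == 0).
  apply/idP/idP => /eqP z; rewrite eq_le measure_ge0 andbT.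
    by rewrite (le_trans (nu_mu _))// z mule0.
  by rewrite (le_trans (mu_nu _))// z mule0.
have -> : (mu setT == +oo) = (nu setT == +oo).
  apply/idP/idP => /eqP z; rewrite -leye_eq.
    by have := mu_nu setT; rewrite z -lee_pdivrMl// gt0_muley// lte_fin invr_gt0.
  by have := nu_mu setT; rewrite z -lee_pdivrMl// gt0_muley// lte_fin invr_gt0.
case: ifPn => [_|].
  by rewrite -[leLHS]mul1e; apply: lee_wpmul2r; rewrite ?lee_fin.
rewrite negb_or => /andP[nu0 nuoo].
have nufin : nu setT \is a fin_num by rewrite ge0_fin_numE ?measure_ge0// ltey.
have mufin : mu setT \is a fin_num.
  rewrite ge0_fin_numE ?measure_ge0// (le_lt_trans (mu_nu _))//.
  by rewrite lte_mul_pinfty// ?lee_fin ?ltW// ltey.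
have := nu_mu setT; rewrite -(fineK nufin) -(fineK mufin) -EFinM lee_fin.
set y := fine (nu _); set x := fine (mu _) => yx.
have y0 : (0 < y)%R by rewrite fine_gt0// lt0e nu0 measure_ge0 ltey.
have x0 : (0 < x)%R by rewrite -(pmulr_rgt0 _ b0) (lt_le_trans y0).
rewrite EFinM muleACA; apply: lee_pmul; rewrite ?measure_ge0 ?mu_nu//.
  by rewrite lee_fin invr_ge0 ltW.
by rewrite -EFinM lee_fin -div1r ler_pdivrMr// mulrAC ler_pdivlMr// mul1r.
Qed.

End gap_comparison.

(** * Accepted densities, Gibbs measures and sampler gaps *)

Section sampler_comparison.
Context (R : realType) (n : nat).
Implicit Types (F : acceptance_rule) (V W : 'rV[R]_n -> R) (p q : proposal R n).

(** Since [expR (log_ratio V q x y) = b / a], the two rules give [a * min(1, b / a)] and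
    [a / (1 + a / b)]. *)
Lemma accepted_densityE F V q x y :
  let a := q x y in let b := expR (V x - V y) * q y x in
  accepted_density F V q x y =
    match F with Metropolis => Num.min a b | Barker => (a^-1 + b^-1)^-1 end.
Proof.
move=> a b; have a0 : 0 < a := proposal_gt0 q x y.
have q0 : 0 < q y x := proposal_gt0 q y x.
have b0 : 0 < b by rewrite mulr_gt0 ?expR_gt0.
have rE : expR (log_ratio V q x y) = b / a.
  by rewrite /log_ratio expRD lnK ?posrE ?divr_gt0// mulrA.
rewrite /accepted_density; case: F => /=; rewrite ?expRN rE -/a.
  by rewrite minr_pMr ?ltW// mulr1 mulrC divfK ?gt_eqF.
rewrite -[X in X * _]invrK -invfM invf_div; congr _^-1.
by rewrite mulrDr mulr1 mulKf ?gt_eqF.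
Qed.

Lemma accepted_density_le F V W p q (o k : R) x y :
  0 <= o -> 0 < k -> (forall x y, p x y <= k * q x y) ->
  W x - W y <= o + (V x - V y) ->
  accepted_density F W p x y <= expR o * k * accepted_density F V q x y.
Proof.
move=> o0 k0 pq WV; rewrite !accepted_densityE.
set a := q x y; set b := expR (V x - V y) * q y x; set c := expR o * k.
set a' := p x y; set b' := expR (W x - W y) * p y x.
have c0 : 0 < c by rewrite mulr_gt0 ?expR_gt0.
have a0 : 0 < a := proposal_gt0 q x y.
have a'0 : 0 < a' := proposal_gt0 p x y.
have b0 : 0 < b by rewrite mulr_gt0 ?expR_gt0 ?proposal_gt0.
have b'0 : 0 < b' by rewrite mulr_gt0 ?expR_gt0 ?proposal_gt0.
(* The potentials enter only through [b']; the factor [expR o >= 1] is inserted here so that both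
   bounds share the constant [c]. *)
have aa : a' <= c * a.
  apply: (le_trans (pq x y)); rewrite -mulrA ler_peMl//.
    by rewrite ltW ?mulr_gt0.
  by rewrite -expR0 ler_expR.
have bb : b' <= c * b.
  rewrite /c /b mulrACA -expRD; apply: ler_pM; rewrite ?expR_ge0 ?ler_expR//.
  exact/ltW/proposal_gt0.
case: F => /=.
  by rewrite minr_pMr ?(ltW c0)// le_min !ge_min aa bb orbT.
rewrite -[c]invrK -invfM mulrDr -!invfM lef_pV2 ?posrE; last 2 first.
- by rewrite addr_gt0 ?invr_gt0.
- by rewrite addr_gt0 ?invr_gt0// mulr_gt0.
by apply: lerD; rewrite lef_pV2 ?posrE// mulr_gt0.
Qed.

Local Open Scope ereal_scope.

(** Rejected moves form a multiple of the Dirac mass at [x], which integrates [h] to zero. *)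
Lemma mh_kernel_integral F V q x (h : 'rV[R]_n -> \bar R) :
  measurable_fun [set: 'rV[R]_n] h -> (forall y, 0 <= h y) -> h x = 0 ->
  \int[mh_kernel F V q x]_y h y =
  \int[with_density (lebesgue_rV n) (accepted_density F V q x)]_y h y.
Proof.
move=> mh h0 hx0; apply: etrans.
  by apply: (ge0_integral_measure_add _ _ measurableT) => // y _; exact: h0.
rewrite ge0_integral_mscale// integral_dirac//.
by rewrite hx0 !mule0 adde0.
Qed.

(** The lower bound [i] gives the factor [expR (- i)] on the weight; the upper bound [s] gives
    [expR s] on the normalizing constant. *)
Lemma gibbs_le V W (i s : R) (A : set 'rV[R]_n) :
  (forall x, i <= W x - V x <= s)%R ->
  gibbs W A <= (expR (s - i))%:E * gibbs V A.
Proof.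
move=> WV; rewrite addrC expRD; apply: mnormalize_le; rewrite ?expR_gt0//.
- by rewrite -expRD -expR0 ler_expR; have := WV 0%R; lra.
- move=> B; apply: with_density_le; rewrite ?expR_gt0// => x.
  by rewrite /gibbs_weight -expRD ler_expR; have := WV x; lra.
- move=> B; apply: with_density_le; rewrite ?expR_gt0// => x.
  by rewrite /gibbs_weight -expRD ler_expR; have := WV x; lra.
Qed.

Lemma sampler_gap_le F V W p q (i s k : R) :
  (0 < k)%R -> (forall x, i <= W x - V x <= s)%R ->
  (forall x y, p x y <= k * q x y)%R ->
  sampler_gap F W p <= (expR (3 * (s - i)) * k)%:E * sampler_gap F V q.
Proof.
move=> k0 WV pq; set o := (s - i)%R.
have o0 : (0 <= o)%R by have := WV 0%R; rewrite /o; lra.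
(* One [expR o] each for the measure in the jump, the accepted density and the variance. *)
have -> : (expR (3 * o) * k = expR o * (expR o * k) * expR o)%R.
  have -> : (3 * o = o + o + o)%R by lra.
  by rewrite !expRD; ring.
apply: Gap_le; rewrite ?mulr_gt0 ?expR_gt0//.
- by move=> B _; exact: gibbs_le.
- move=> B _; have -> : (o = - i - - s)%R by rewrite /o; lra.
  by apply: gibbs_le => x; have := WV x; lra.
- move=> f x mf.
  have mjump : measurable_fun setT (fun y => ((`|f y - f x| ^+ 2)%R)%:E).
    apply/measurable_EFinP/measurable_funX/measurableT_comp => //.
    exact: measurable_funB.
  rewrite !mh_kernel_integral//; try by rewrite subrr normr0 expr0n.
  rewrite -[(expR o * k)%R]mulr1; apply: ge0_integral_le_scale => //.
  + by rewrite mulr_ge0 ?expR_ge0// ltW.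
  + move=> B _; apply: with_density_le; rewrite ?mulr_gt0 ?expR_gt0// => y.
    apply: accepted_density_le => //.
    by have := WV x; have := WV y; rewrite /o; lra.
  + by move=> y; rewrite mul1e.
Qed.

(** Integrating the bound in [y], from the starting point 0, compares two unit masses. *)
Lemma proposal_ratio_ge1 p q (k : R) :
  (0 < k)%R -> (forall x y, p x y <= k * q x y)%R -> (1 <= k)%R.
Proof.
move=> k0 pq; rewrite -lee_fin -(proposal_int1 p 0%R).
rewrite -[k]mul1r -[leRHS]mule1 -(proposal_int1 q 0%R).
apply: ge0_integral_le_scale => //.
- by move=> B _; rewrite mul1e.
- by move=> y; rewrite lee_fin ltW// proposal_gt0.
- by move=> y; rewrite -EFinM lee_fin.
Qed.

End sampler_comparison.

Theorem corollary2p9 (R : realType) (n : nat)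
    (V0 : 'rV[R]_n -> R) (V1 : 'rV[R]_n * 'rV[R]_n -> R)
    (F : acceptance_rule) (q0 : proposal R n) (q : R -> proposal R n)
    (C D : R) :
  smooth V0 ->
  (exists m : R, forall x, m <= V0 x) ->
  (forall M : R, exists r : R, forall x, r < `|x| -> M < V0 x) ->
  (lebesgue_rV n).-integrable setT (fun x => (expR (- V0 x))%:E) ->
  smooth V1 ->
  (exists M : R, forall z, `|V1 z| <= M) ->
  (exists M : R, forall eps : R, 0 < eps -> osc V1 eps <= M) ->
  0 < C -> 0 < D ->
  (forall eps : R, 0 < eps -> forall x y : 'rV[R]_n,
     C * q0 x y <= q eps x y <= D * q0 x y) ->
  forall eps : R, 0 < eps ->
    ((expR (- 3 * osc V1 eps) * (C / D))%:E * sampler_gap F V0 q0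
       <= sampler_gap F (multiscale V0 V1 eps) (q eps)
       <= (expR (3 * osc V1 eps) * (D / C))%:E * sampler_gap F V0 q0)%E.
Proof.
move=> _ _ _ _ _ [M V1M] _ C0 D0 q_bounds eps eps0.
have {q_bounds} qb := q_bounds eps eps0.
have qD x y : q eps x y <= D * q0 x y by have /andP[] := qb x y.
have q0C x y : q0 x y <= C^-1 * q eps x y.
  by rewrite mulrC ler_pdivlMr// mulrC; have /andP[] := qb x y.
have D_ge1 : 1 <= D := proposal_ratio_ge1 D0 qD.
have C_le1 : C <= 1.
  by rewrite -invf_ge1//; apply: proposal_ratio_ge1 q0C; rewrite invr_gt0.
set V1e := fun x : 'rV[R]_n => V1 (x, eps^-1 *: x).
have V1eM x : - M <= V1e x <= M by rewrite -ler_norml; exact: V1M.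
(* Boundedness of [V1] keeps [sup] and [inf] from being default values. *)
have V1eb x : inf (range V1e) <= V1e x <= sup (range V1e).
  apply/andP; split.
    apply: ge_inf; last by exists x.
    by exists (- M) => _ [y _ <-]; have /andP[] := V1eM y.
  apply: ub_le_sup; last by exists x.
  by exists M => _ [y _ <-]; have /andP[] := V1eM y.
have oscE : osc V1 eps = sup (range V1e) - inf (range V1e) by [].
rewrite oscE {oscE}; move: (inf _) (sup _) V1eb => i s V1eb.
apply/andP; split.
(* The same comparison with the samplers exchanged: the potential difference lies between [- s] and
   [- i], and [q0] is at most [C^-1] times [q eps]. *)
- have : (sampler_gap F V0 q0 <= (expR (3 * (s - i)) * C^-1)%:E *
      sampler_gap F (multiscale V0 V1 eps) (q eps))%E.
    rewrite (_ : s - i = - i - - s); last by rewrite opprK addrC.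
    apply: sampler_gap_le => //; first by rewrite invr_gt0.
    by move=> x; have := V1eb x; rewrite /multiscale -/(V1e x); lra.
  rewrite -lee_pdivrMl ?mulr_gt0 ?expR_gt0 ?invr_gt0//; apply: le_trans.
  apply: lee_wpmul2r; first exact: Gap_ge0.
  (* The comparison yields the constant [C], weakened to [C / D] by [1 <= D]. *)
  rewrite lee_fin invfM invrK -expRN mulNr.
  by rewrite ler_pM2l ?expR_gt0// ler_pdivrMr// ler_peMr// ltW.
- apply: (@le_trans _ _ ((expR (3 * (s - i)) * D)%:E * sampler_gap F V0 q0)%E).
    apply: sampler_gap_le => // x.
    by have := V1eb x; rewrite /multiscale -/(V1e x); lra.
  apply: lee_wpmul2r; first exact: Gap_ge0.
  (* Here [D] is weakened to [D / C] by [C <= 1]. *)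
  rewrite lee_fin ler_pM2l ?expR_gt0//.
  by rewrite ler_pdivlMr// ler_piMr// ltW.
Qed.
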